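(* Let $G=(V,E,W)$ be a finite simple undirected graph with positive edge weights $w(e)>0$ for $e\in E$. Let $\mathrm{cover}$ be the path cover of $G$ produced by the Sequential Optimized Path Cover algorithm (described in the context), and let $OPT$ be a path cover of $G$ of maximum total weight. Then $$w(\mathrm{cover})\ \ge\ \tfrac12\, w(OPT).$$
   Context: A path cover of a graph $G=(V,E)$ is a set of paths in $G$ such that every vertex of $G$ belongs to exactly one of the paths; a path may consist of a single vertex (and no edges). The weight $w(P)$ of a path cover $P$ is the sum of the weights of all edges of its paths. Sequential Optimized Path Cover algorithm. Input: a finite simple undirected graph $G=(V,E,W)$ with positive edge weights. Sort the edges in descending order of weight (ties broken arbitrarily) into a list $L$, and let $\mathrm{cover}$ be empty. Process the edges $e=\{u,v\}$ of $L$ in order, skipping those which have been removed from $L$ before being reached. For each processed edge $\{u,v\}$: (i) if neither $u$ nor $v$ is in any path in $\mathrm{cover}$, add the path consisting of the edge $\{u,v\}$ as a new path in $\mathrm{cover}$; (ii) else if $u$ is an endpoint of a path in $\mathrm{cover}$ and $v$ is not in any path, extend that path by the edge $\{u,v\}$, so that $v$ becomes an endpoint, and remove from $L$ all edges incident to $u$ in $G$ that are not in $\mathrm{cover}$; (iii) else if $v$ is an endpoint of a path in $\mathrm{cover}$ and $u$ is not in any path, extend that path by the edge $\{u,v\}$, so that $u$ becomes an endpoint, and remove from $L$ all edges incident to $v$ in $G$ that are not in $\mathrm{cover}$; (iv) else if $u$ and $v$ are endpoints of two different paths in $\mathrm{cover}$, merge these two paths through the edge $\{u,v\}$, and remove from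 $L$ all edges incident to $u$ or to $v$ in $G$ that are not in $\mathrm{cover}$; (v) otherwise do nothing. At the end, output $\mathrm{cover}$, where every vertex not contained in any path is regarded as a single-vertex path. *)

(* Defs.v *)
From mathcomp Require Import all_boot all_order all_algebra.
Set Implicit Arguments. Unset Strict Implicit. Unset Printing Implicit Defensive.
Import Order.TTheory GRing.Theory Num.Theory.
Local Open Scope ring_scope.

Section Graphs.
Variable T : finType.
Implicit Types (E : {set {set T}}) (p q : seq T) (C P : seq (seq T)).

(* A graph on the vertex type T is given by its set E of edges, each edge
   being an unordered pair of distinct vertices. *)
Definition simple_graph E := forall f : {set T}, f \in E -> #|f| = 2%N.

Definition edge (x : T * T) : {set T} := [set x.1; x.2].

Definition adj E : rel T := fun u v => edge (u, v) \in E.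

(* A path is listed by its successive vertices; a list and its reversal
   stand for the same undirected path. *)
Definition is_path E p := [&& p != [::], uniq p & sorted (adj E) p].

Definition path_edges p : seq {set T} := [seq edge x | x <- zip p (behead p)].

Definition path_cover E P :=
  all (is_path E) P /\ forall v : T, count (fun p => v \in p) P = 1%N.

Definition weight (R : realFieldType) (W : {set T} -> R) P : R :=
  \sum_(p <- P) \sum_(f <- path_edges p) W f.

Definition max_path_cover (R : realFieldType) E (W : {set T} -> R) P :=
  path_cover E P /\ forall Q, path_cover E Q -> weight W Q <= weight W P.

(* Every edge occurs exactly once in L, under either naming (u, v) or (v, u)
   of its ends; ties may be ordered in any way. *)
Definition descending_edge_list (R : realFieldType) E (W : {set T} -> R)
    (L : seq (T * T)) :=
  perm_eq [seq edge x | x <- L] (enum E) /\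
  sorted >=%R [seq W (edge x) | x <- L].

Definition covered C (v : T) := has (fun p => v \in p) C.

Definition endpoint (u : T) p :=
  if p is x :: s then (u == x) || (u == last x s) else false.

(* The path of C with endpoint u, or [::] if there is none; it is unique when
   the paths of C are vertex-disjoint. *)
Definition path_at C (u : T) := nth [::] C (find (endpoint u) C).

(* p, reversed if necessary so as to end (resp. start) at its endpoint u. *)
Definition ending_at (u : T) p := if last u p == u then p else rev p.
Definition starting_at (u : T) p := if head u p == u then p else rev p.

Definition extend C (u v : T) :=
  let p := path_at C u in rcons (ending_at u p) v :: rem p C.

Definition merge_paths C (u v : T) :=
  let p := path_at C u in let q := path_at C v in
  (ending_at u p ++ starting_at v q) :: rem q (rem p C).

Definition unused_incident E C (u : T) : {set {set T}} :=
  [set f in E | (u \in f) && (f \notin flatten [seq path_edges p | p <- C])].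

(* A state (C, X) consists of the current cover C and of the set X of the edges
   that have been removed from the list. *)
Definition sopc_step E (st : seq (seq T) * {set {set T}}) (x : T * T) :=
  let: (C, X) := st in
  let: (u, v) := x in
  if edge (u, v) \in X then (C, X)
  else if ~~ covered C u && ~~ covered C v then ([:: u; v] :: C, X)
  else if has (endpoint u) C && ~~ covered C v then
    let C' := extend C u v in (C', X :|: unused_incident E C' u)
  else if has (endpoint v) C && ~~ covered C u then
    let C' := extend C v u in (C', X :|: unused_incident E C' v)
  else if [&& has (endpoint u) C, has (endpoint v) C
            & path_at C u != path_at C v] then
    let C' := merge_paths C u v in
    (C', X :|: unused_incident E C' u :|: unused_incident E C' v)
  else (C, X).

Definition sopc E (L : seq (T * T)) : seq (seq T) :=
  let C := (foldl (sopc_step E) ([::], set0) L).1 in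
  C ++ [seq [:: v] | v <- enum T & ~~ covered C v].

End Graphs.

(* Main.v *)
Require Import Defs.
From mathcomp Require Import all_boot all_order all_algebra.
From mathcomp Require Import lra.
Import Order.TTheory GRing.Theory Num.Theory.
Local Open Scope ring_scope.

(** The bound comes from comparing edge counts on every prefix of the sorted
list.  Say that a path p blocks an edge f when f still meets p after either end
of p is deleted: f contains an inner vertex of p, or two vertices of p.  An
edge that has been dealt with is blocked by some path of the current cover: if
it was accepted it lies on a path, if it was rejected one of its ends is an
inner vertex or both are the ends of one path, and if it was removed it
contains a vertex that has become inner.  Blocking is symmetric under
reversal and survives the growth of paths, so this is an invariant
([step_spec], [run_spec]).

A path p with k edges has k vertices besides its first one, and every edge it
blocks contains one of these k.  Since a path cover OPT has degree at most 2 at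
each vertex, at most 2k of its edges are blocked by p.  Hence, after each
prefix of the list, OPT contains at most twice as many of the edges dealt with
as the algorithm has accepted ([blocked_count_le]).  As the weights decrease
along the list and are nonnegative, summation by parts turns these
inequalities between counts into the inequality between weights
([greedy_le]). *)

Set Implicit Arguments. Unset Strict Implicit. Unset Printing Implicit Defensive.

(** * Edges of a family of paths *)

Section PathEdges.
Variable T : finType.
Implicit Types (f : {set T}) (p q : seq T) (C P O : seq (seq T)).

Lemma edgeC (u v : T) : edge (u, v) = edge (v, u).
Proof. by rewrite /edge /= setUC. Qed.

Lemma path_edges_cons (x y : T) p :
  path_edges (x :: y :: p) = edge (x, y) :: path_edges (y :: p).
Proof. by []. Qed.

Lemma path_edges_cat (x y : T) p q :
  path_edges (rcons p x ++ y :: q) =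
  path_edges (rcons p x) ++ edge (x, y) :: path_edges (y :: q).
Proof.
elim: p => [|z p IHp] //; case: p IHp => [|z' p] IHp //.
by rewrite !rcons_cons !cat_cons !path_edges_cons -[in LHS]cat_cons -rcons_cons IHp.
Qed.

Lemma perm_path_edges_rev p : perm_eq (path_edges (rev p)) (path_edges p).
Proof.
elim: p => [|x [|y p] IHp] //.
rewrite rev_cons rev_cons -cats1 path_edges_cat path_edges_cons edgeC.
by rewrite -rev_cons perm_catC /= perm_cons.
Qed.

Lemma size_path_edges p : size (path_edges p) = (size p).-1.
Proof. by rewrite size_map size_zip size_behead; case: p => //= x p; apply/minn_idPr. Qed.

Definition cover_edges C : seq {set T} := flatten [seq path_edges p | p <- C].

Lemma weightE (R : realFieldType) (W : {set T} -> R) C :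
  weight W C = \sum_(f <- cover_edges C) W f.
Proof. by rewrite /weight /cover_edges big_flatten big_map. Qed.

Lemma perm_cover_edges C C' :
  perm_eq C C' -> perm_eq (cover_edges C) (cover_edges C').
Proof. by move=> CC'; apply/perm_flatten/perm_map. Qed.

(** Each edge of p through v has v as its first or its second vertex in the order
of p, and the list of the second vertices is [behead p]. *)
Lemma count_path_edges_le (v : T) p :
  (count (fun f : {set T} => v \in f) (path_edges p) <= 2 * count_mem v p)%N.
Proof.
suff H : (count (fun f : {set T} => v \in f) (path_edges p)
          <= count_mem v p + count_mem v (behead p))%N.
  apply: leq_trans H _; rewrite mul2n -addnn leq_add2l.
  by case: p => //= x p; rewrite leq_addl.
elim: p => [|x [|y p] IHp] //.
rewrite path_edges_cons [X in (X <= _)%N]/=.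
have -> : count_mem v (x :: y :: p) = ((x == v) + count_mem v (y :: p))%N by [].
rewrite addnAC -[behead (x :: _)]/(y :: p) /=; move: IHp => /= IHp.
rewrite (leq_trans (leq_add (leqnn _) IHp)) //.
rewrite [X in (_ <= X)%N]addnC [X in (_ <= X)%N]addnC.
have H : ((v \in edge (x, y)) <= (x == v) + (y == v))%N.
  by rewrite !inE ![v == _]eq_sym; case: (x == v); case: (y == v).
apply: leq_trans (leq_add H (leqnn _)) _.
by rewrite -!addnA leq_add2l; rewrite addnCA leq_add2l addnC leqnn.
Qed.

(** The vertex v occurs once in just one of the paths. *)
Lemma path_cover_degree_le2 E P (v : T) : path_cover E P ->
  (count (fun f : {set T} => v \in f) (cover_edges P) <= 2)%N.
Proof.
case=> /allP pathP /(_ v) coverP.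
rewrite /cover_edges count_flatten -map_comp -[leqRHS]muln1 -[X in (_ <= 2 * X)%N]coverP.
rewrite -sum1_count big_mkcond /= sumnE big_map big_distrr /=.
rewrite big_seq [leqRHS]big_seq; apply: leq_sum => p /pathP/and3P[_ Up _].
by apply: leq_trans (count_path_edges_le _ _) _; rewrite count_uniq_mem //=.
Qed.

Lemma path_cover_edges_sub E P : path_cover E P -> {subset cover_edges P <= E}.
Proof.
case=> /allP pathP _ f /flatten_mapP[p /pathP/and3P[_ _]].
elim: p => [|x [|y p] IHp] //= /andP[Exy] /IHp{}IHp.
by rewrite path_edges_cons inE => /predU1P[->|].
Qed.

(** * Blocked edges *)

Definition meets f p := has [in f] p.

(** The list [behead (rev p)] is p without its last vertex, read backwards. *)
Definition blocked f p := meets f (behead p) && meets f (behead (rev p)).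

Definition blocked_by C f := has (blocked f) C.

Lemma blocked_rev f p : blocked f (rev p) = blocked f p.
Proof. by rewrite /blocked revK andbC. Qed.

(** Deleting the first vertex of [p ++ q] deletes at most the first vertex of p and
the first vertex of q, and likewise for the last vertices. *)
Lemma blocked_cat f p q : blocked f p || blocked f q -> blocked f (p ++ q).
Proof.
rewrite /blocked /meets rev_cat.
have behead_has s t a : has a (behead s) || has a (behead t) -> has a (behead (s ++ t)).
  case: s => [|x s] //=; rewrite has_cat => /orP[->//|].
  by case: t => //= y t ->; rewrite !orbT.
by case/orP=> /andP[Hb Hr]; rewrite !behead_has ?Hb ?Hr ?orbT.
Qed.

Lemma blocked_inner f (u : T) p q :
  u \in f -> p != [::] -> q != [::] -> blocked f (p ++ u :: q).
Proof.
have H s t : u \in f -> s != [::] -> meets f (behead (s ++ u :: t)).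
  by case: s => // x s uf _; rewrite /meets /= has_cat /= uf orbT.
move=> uf p0 q0; rewrite /blocked H // rev_cat rev_cons cat_rcons H //.
by case: q q0 => // y q _; rewrite rev_cons -size_eq0 size_rcons.
Qed.

Lemma blocked_mem f (v : T) p :
  v \in f -> v \in p -> ~~ endpoint v p -> blocked f p.
Proof.
move=> vf; case: p => // x p; rewrite /= negb_or => vp /andP[vx vl].
apply/andP; split; apply/hasP; exists v => //=.
  by move: vp; rewrite inE (negPf vx).
move: vp; rewrite -mem_rev; case/lastP: p vl => [|p y] /=; first by rewrite !inE (negPf vx).
by rewrite last_rcons rev_cons rev_rcons /= inE => /negPf->.
Qed.

Lemma blocked_pair f (u v : T) p : u != v -> u \in f -> v \in f ->
  u \in p -> v \in p -> blocked f p.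
Proof.
have H q : u != v -> u \in f -> v \in f -> u \in q -> v \in q -> meets f (behead q).
  case: q => // x q uv uf vf; rewrite !inE.
  case/predU1P=> [ux|uq]; last by move=> _; apply/hasP; exists u.
  by case/predU1P=> [vx|vq]; [rewrite ux vx eqxx in uv | apply/hasP; exists v].
by move=> uv uf vf up vp; rewrite /blocked !H ?mem_rev.
Qed.

(** * Growing paths *)

Lemma path_atP C (u : T) : has (endpoint u) C ->
  path_at C u \in C /\ endpoint u (path_at C u).
Proof. by move=> uC; rewrite /path_at mem_nth ?nth_find // -has_find. Qed.

(** [ending_at] and [starting_at] may or may not reverse a path; edges, length and
blocking do not depend on which of the two happens. *)
Variant same_path p : seq T -> Prop :=
  | SamePath : same_path p p
  | SamePathRev : same_path p (rev p).

Lemma ending_at_same (u : T) p : same_path p (ending_at u p).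
Proof. by rewrite /ending_at; case: ifP; constructor. Qed.

Lemma starting_at_same (u : T) p : same_path p (starting_at u p).
Proof. by rewrite /starting_at; case: ifP; constructor. Qed.

Lemma same_path_size p q : same_path p q -> size q = size p.
Proof. by case; rewrite ?size_rev. Qed.

Lemma same_path_edges p q : same_path p q -> perm_eq (path_edges q) (path_edges p).
Proof. by case; rewrite ?perm_path_edges_rev. Qed.

Lemma same_path_blocked f p q : same_path p q -> blocked f q = blocked f p.
Proof. by case; rewrite ?blocked_rev. Qed.

Lemma ending_atE (u : T) p : endpoint u p -> exists s, ending_at u p = rcons s u.
Proof.
rewrite /ending_at; case: p => // x p /= eu; case: ifPn => [/eqP<-|uNl].
  by exists (belast x p); rewrite -lastI.
have /eqP-> : u == x by move: eu; rewrite [u == last x p]eq_sym (negPf uNl) orbF.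
by exists (rev p); rewrite rev_cons.
Qed.

Lemma starting_atE (u : T) p : endpoint u p -> exists s, starting_at u p = u :: s.
Proof.
rewrite /starting_at; case: p => // x p /= eu; case: ifPn => [/eqP<-|uNx]; first by exists p.
have /eqP-> : u == last x p by move: eu; rewrite [u == x]eq_sym (negPf uNx).
by exists (rev (belast x p)); rewrite lastI rev_rcons.
Qed.

(** The algorithm only stores paths with at least one edge, so that an end of a
stored path becomes inner once an edge is added there. *)
Definition long_paths C := all (fun p => 1 < size p)%N C.

(** The third conclusion holds because u becomes an inner vertex: the extended path
already had another vertex before u. *)
Lemma extend_spec C (u v : T) : long_paths C -> has (endpoint u) C ->
  [/\ long_paths (extend C u v),
      forall f, blocked_by C f -> blocked_by (extend C u v) f,
      forall f, u \in f -> blocked_by (extend C u v) f &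
      perm_eq (cover_edges (extend C u v)) (edge (u, v) :: cover_edges C)].
Proof.
move=> longC /path_atP[]; rewrite /extend; set p := path_at C u => pC /ending_atE[s Es].
have permC := perm_to_rem pC; have samep := ending_at_same u p.
have /andP[long_p longC'] : long_paths (p :: rem p C).
  by rewrite /long_paths -(perm_all _ permC).
have := same_path_size samep; have := same_path_blocked _ samep.
have := same_path_edges samep; rewrite {}Es => edges_p blocked_p size_p.
rewrite /blocked_by; split.
- by apply/andP; split; rewrite // size_rcons size_p ltnW.
- move=> f; rewrite (perm_has _ permC) /= -blocked_p -[rcons (rcons s u) v]cats1.
  by case/orP=> [bf|->]; rewrite ?orbT // blocked_cat ?bf.
- move=> f uf; rewrite /= -cats1 cat_rcons blocked_inner //.
  by move: long_p; rewrite -size_p size_rcons; case: (s).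
apply: perm_trans (_ : perm_eq _ (edge (u, v) :: cover_edges (p :: rem p C))) _.
  rewrite /cover_edges /= -cats1 path_edges_cat -cat_cons perm_cat2r -cat1s perm_catC /=.
  by rewrite perm_cons.
by rewrite perm_cons perm_cover_edges // perm_sym.
Qed.

Lemma merge_spec C (u v : T) :
  long_paths C -> has (endpoint u) C -> has (endpoint v) C ->
  path_at C u != path_at C v ->
  [/\ long_paths (merge_paths C u v),
      forall f, blocked_by C f -> blocked_by (merge_paths C u v) f,
      forall f, (u \in f) || (v \in f) -> blocked_by (merge_paths C u v) f &
      perm_eq (cover_edges (merge_paths C u v)) (edge (u, v) :: cover_edges C)].
Proof.
move=> longC /path_atP[]; rewrite /merge_paths.
set p := path_at C u => pC /ending_atE[s Es] /path_atP[].
set q := path_at C v => qC /starting_atE[t Et] pq.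
have permC : perm_eq C (p :: q :: rem q (rem p C)).
  apply: perm_trans (perm_to_rem pC) _; rewrite perm_cons perm_to_rem //.
  by have := perm_mem (perm_to_rem pC) q; rewrite qC inE eq_sym (negPf pq).
have samep := ending_at_same u p; have sameq := starting_at_same v q.
have /and3P[long_p long_q longC'] : long_paths (p :: q :: rem q (rem p C)).
  by rewrite /long_paths -(perm_all _ permC).
have := same_path_size samep; have := same_path_blocked _ samep.
have := same_path_edges samep; rewrite {}Es => edges_p blocked_p size_p.
have := same_path_size sameq; have := same_path_blocked _ sameq.
have := same_path_edges sameq; rewrite {}Et => edges_q blocked_q size_q.
rewrite /blocked_by; split.
- by apply/andP; split; rewrite // size_cat size_p ltn_addr.
- move=> f; rewrite (perm_has _ permC) /= -blocked_p -blocked_q orbA.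
  by case/orP=> [bf|->]; rewrite ?orbT // blocked_cat ?bf.
- have s0 : s != [::] by move: long_p; rewrite -size_p size_rcons; case: (s).
  have t0 : t != [::] by move: long_q; rewrite -size_q; case: (t).
  move=> f /= /orP[uf|vf]; first by rewrite cat_rcons blocked_inner.
  by rewrite blocked_inner // -size_eq0 size_rcons.
apply: perm_trans
  (_ : perm_eq _ (edge (u, v) :: cover_edges (p :: q :: rem q (rem p C)))) _.
  rewrite /cover_edges /= path_edges_cat -catA -cat1s perm_catCA /= perm_cons.
  by rewrite perm_catCA; do 2!apply: perm_cat => //.
by rewrite perm_cons perm_cover_edges // perm_sym.
Qed.

(** * The invariant of the algorithm *)

(** In the branches that leave the cover unchanged, the edge is in X, or one of its
ends is covered but is not an end of any path, or both of its ends lie on the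
same path. *)
Lemma step_spec E C (X : {set {set T}}) (x : T * T) : x.1 != x.2 ->
  long_paths C -> (forall f, f \in X -> blocked_by C f) ->
  let: (C', X') := sopc_step E (C, X) x in
  [/\ long_paths C',
      forall f, blocked_by C f -> blocked_by C' f,
      blocked_by C' (edge x),
      forall f, f \in X' -> blocked_by C' f &
      perm_eq (cover_edges C') (cover_edges C) \/
      perm_eq (cover_edges C') (edge x :: cover_edges C)].
Proof.
case: x => u v /= uv longC blockX.
have ue : u \in edge (u, v) by rewrite !inE eqxx.
have ve : v \in edge (u, v) by rewrite !inE eqxx orbT.
case: ifP => [eX|_]; first by split; auto.
case: ifP => [_|cov_uv].
  have blockC f : blocked_by C f -> blocked_by ([:: u; v] :: C) f.
    by rewrite /blocked_by /= => ->; rewrite orbT.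
  split; auto; first by rewrite /blocked_by /= (@blocked_pair _ u v) ?inE ?eqxx ?orbT.
case: ifP => [/andP[eu _]|Nu].
  have [longC' monoC' blocku permC'] := extend_spec v longC eu; split; auto.
  by move=> f /setUP[/blockX/monoC' //|]; rewrite inE => /and3P[_ /blocku].
case: ifP => [/andP[ev _]|Nv].
  have [longC' monoC' blockv permC'] := extend_spec u longC ev.
  rewrite [edge (u, v)]edgeC; split; auto; first by rewrite blockv // edgeC.
  by move=> f /setUP[/blockX/monoC' //|]; rewrite inE => /and3P[_ /blockv].
case: ifP => [/and3P[eu ev pq]|Nuv].
  have [longC' monoC' blockuv permC'] := merge_spec longC eu ev pq.
  split; auto; first by rewrite blockuv // ue.
  move=> f /setUP[/setUP[/blockX/monoC' //|]|]; rewrite inE => /and3P[_ zf _];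
  by rewrite blockuv ?zf ?orbT.
split; auto.
(* What remains is to block the edge when it is rejected. *)
have inner z : z \in edge (u, v) -> covered C z -> ~~ has (endpoint z) C ->
    blocked_by C (edge (u, v)).
  move=> ze /hasP[p pC zp] /hasPn/(_ p pC) zNp; apply/hasP; exists p => //.
  exact: blocked_mem ze zp zNp.
have [eu|/inner] := boolP (has (endpoint u) C); last first.
  move=> Hu; have [/Hu->//|uNc] := boolP (covered C u).
  have [vc|/negPf vNc] := boolP (covered C v); last by rewrite uNc vNc in cov_uv.
  by apply: (inner v) => //; apply/negP => ev; rewrite ev uNc in Nv.
have [vc|vNc] := boolP (covered C v); last by rewrite eu vNc in Nu.
have [ev|vNe] := boolP (has (endpoint v) C); last exact: inner vNe.
have memE z p : endpoint z p -> z \in p.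
  by case: p => //= y p /orP[]/eqP->; rewrite ?mem_head ?mem_last.
rewrite eu ev /= in Nuv; move/negbFE/eqP: Nuv => pq.
have [pC /memE up] := path_atP eu; have [_ /memE vp] := path_atP ev.
apply/hasP; exists (path_at C u) => //.
by apply: (@blocked_pair _ u v) => //; rewrite pq.
Qed.

Lemma run_spec E (L : seq (T * T)) : (forall x, x \in L -> x.1 != x.2) ->
  let: (C, X) := foldl (sopc_step E) ([::], set0) L in
  [/\ long_paths C, forall f, f \in X -> blocked_by C f &
      forall f, f \in [seq edge x | x <- L] -> blocked_by C f].
Proof.
elim/last_ind: L => [|L x IHL] Lneq; first by split=> // f; rewrite inE.
have /IHL{IHL} : forall y, y \in L -> y.1 != y.2.
  by move=> y yL; apply: Lneq; rewrite mem_rcons inE yL orbT.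
have xneq : x.1 != x.2 by apply: Lneq; rewrite mem_rcons mem_head.
rewrite foldl_rcons; case: (foldl _ _ _) => C X [longC blockX blockL].
have := step_spec E xneq longC blockX; case: (sopc_step E _ x) => C' X'.
case=> longC' monoC' blockx blockX' _; split=> // f.
rewrite map_rcons mem_rcons inE => /predU1P[->//|/blockL]; exact: monoC'.
Qed.

(** * Counting and summing *)

(** An edge blocked by p meets [behead p], and these tails have together as many
vertices as the cover has edges; each of them lies on at most two edges of O. *)
Lemma blocked_count_le (O : seq {set T}) (B : pred {set T}) C :
  (forall v : T, count (fun f : {set T} => v \in f) O <= 2)%N ->
  (forall f, B f -> blocked_by C f) ->
  (count B O <= 2 * size (cover_edges C))%N.
Proof.
move=> deg2 blockB.
pose tails := flatten [seq behead p | p <- C].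
have -> : size (cover_edges C) = size tails.
  rewrite !size_flatten /shape -!map_comp; congr sumn; apply: eq_map => p /=.
  by rewrite size_path_edges size_behead.
have {blockB} : forall f, B f -> meets f tails.
  move=> f /blockB/hasP[p pC /andP[/hasP[v vp vf] _]].
  by apply/hasP; exists v => //; apply/flatten_mapP; exists p.
elim: tails B => [|v s IHs] B hitB; first by
  rewrite muln0 leqNgt -has_count; apply/hasPn => f _; apply/negP => /hitB.
pose atv (f : {set T}) := v \in f; pose B' f := B f && (v \notin f).
apply: (@leq_trans (count (predU atv B') O)).
  by apply: sub_count => f /=; rewrite /atv /B' => ->; case: (v \in f).
apply: (@leq_trans (count atv O + count B' O)); first by rewrite -count_predUI leq_addr.
rewrite mulnS leq_add ?deg2 //.
by apply: IHs => f /andP[/hitB]; rewrite /meets /= => /orP[->|].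
Qed.

End PathEdges.

Section Greedy.
Variables (R : realFieldType) (T : finType) (E : {set {set T}}) (W : {set T} -> R).

(** This is summation by parts, written as an induction on the prefixes of the
list: the excess of twice the accepted edges over the edges of O is never
negative, so that the surplus weight is at least this excess times the latest,
hence smallest, weight.  The bound w, anything below all the weights seen so
far, is what lets the induction pass to the next, smaller weight. *)
Lemma greedy_le (O : seq {set T}) (L : seq (T * T)) (w : R) :
  (forall v : T, count (fun f : {set T} => v \in f) O <= 2)%N ->
  (forall x, x \in L -> x.1 != x.2) ->
  uniq [seq edge x | x <- L] ->
  sorted >=%R [seq W (edge x) | x <- L] ->
  (forall x, x \in L -> w <= W (edge x)) ->
  let C := (foldl (sopc_step E) ([::], set0) L).1 in
  let: B := [in [seq edge x | x <- L]] in
  ((2 * size (cover_edges C))%:R - (count B O)%:R) * w <=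
  2 * weight W C - \sum_(f <- O | B f) W f.
Proof.
move=> deg2; elim/last_ind: L w => [|L x IHL] w Lneq UL sortL wL /=.
  by rewrite big_pred0 // count_pred0 /weight big_nil muln0 mulr0 !subrr mul0r.
have LneqL y : y \in L -> y.1 != y.2.
  by move=> yL; apply: Lneq; rewrite mem_rcons inE yL orbT.
have xneq : x.1 != x.2 by apply: Lneq; rewrite mem_rcons mem_head.
have wx : w <= W (edge x) by apply: wL; rewrite mem_rcons mem_head.
move: UL sortL; rewrite !map_rcons rcons_uniq => /andP[xNL UL].
rewrite sorted_pairwise; last exact: ge_trans.
rewrite -cats1 pairwise_cat allrel1r => /and3P[/allP Lx pairL _].
have Wx y : y \in L -> W (edge x) <= W (edge y).
  by move=> yL; apply: Lx; apply: map_f.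
rewrite -sorted_pairwise in pairL; last exact: ge_trans.
have {IHL} := IHL (W (edge x)) LneqL UL pairL Wx.
have := run_spec E Lneq; have := run_spec E LneqL; rewrite foldl_rcons.
case: (foldl _ _ _) => C X [longC blockX _].
have := step_spec E xneq longC blockX; case: (sopc_step E _ x) => C' X' /=.
case=> _ _ _ _ stepC' [_ _ blockL'].
set B := [in [seq edge x | x <- L]].
pose B' := predU (pred1 (edge x)) B.
have memB' : [in rcons [seq edge x | x <- L] (edge x)] =1 B'.
  by move=> f; rewrite /= mem_rcons inE.
have disjB : predI (pred1 (edge x)) B =1 pred0.
  by move=> f /=; apply/negP => /andP[/eqP->]; apply/negP.
rewrite (eq_count memB') (eq_bigl _ _ memB').
have count_le : (count B' O <= 2 * size (cover_edges C'))%N.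
  apply: blocked_count_le => // f; rewrite -memB' => fL.
  by apply: blockL'; rewrite map_rcons.
have countE : count B' O = (count_mem (edge x) O + count B O)%N.
  by rewrite -count_predUI (eq_count disjB) count_pred0 addn0.
have sumE : \sum_(f <- O | B' f) W f =
    (count_mem (edge x) O)%:R * W (edge x) + \sum_(f <- O | B f) W f.
  rewrite (bigID (pred1 (edge x))) /=; congr (_ + _).
    rewrite (eq_bigl (pred1 (edge x))); last first.
      by move=> f; rewrite /B' /=; case: (f == edge x); rewrite ?andbF.
    rewrite (eq_bigr (fun=> W (edge x))) => [|f /eqP->//].
    by rewrite big_const_seq iter_addr_0 mulr_natl.
  apply: eq_bigl => f; rewrite /B' /=; case: (eqVneq f (edge x)) => [->|_] /=.
    by rewrite /B /= (negPf xNL).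
  by rewrite andbT.
have gap_ge0 : 0 <= (2 * size (cover_edges C'))%:R - (count B' O)%:R :> R.
  by rewrite subr_ge0 ler_nat.
(* By gap_ge0 the bound w may be raised to the weight of x, at which the two sides
   of the induction hypothesis grow by the same amount. *)
move=> IH; apply: le_trans (ler_wpM2l gap_ge0 wx) _; move: IH.
rewrite sumE countE !weightE !natrM natrD.
by case: stepC' => /[dup] /perm_size-> /(perm_big _)->; rewrite ?big_cons /= ?mulrSr; lra.
Qed.

End Greedy.

Theorem mainTheorem1 (R : realFieldType) (T : finType) (E : {set {set T}})
    (W : {set T} -> R)
    (hE : simple_graph E) (hW : forall f : {set T}, f \in E -> 0 < W f)
    (L : seq (T * T)) (hL : descending_edge_list E W L)
    (OPT : seq (seq T)) (hOPT : max_path_cover E W OPT) :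
  weight W (sopc E L) >= 2^-1 * weight W OPT.
Proof.
have [permL sortL] := hL; have [coverOPT _] := hOPT.
have memL : [seq edge x | x <- L] =i E by move=> f; rewrite (perm_mem permL) mem_enum.
have xE x : x \in L -> edge x \in E by move=> xL; rewrite -memL map_f.
have Lneq x : x \in L -> x.1 != x.2.
  by move=> /xE/hE; rewrite /edge cards2; case: eqP.
have UL : uniq [seq edge x | x <- L] by rewrite (perm_uniq permL) enum_uniq.
have L0 x : x \in L -> 0 <= W (edge x) by move=> /xE/hW/ltW.
have := greedy_le E (fun v => path_cover_degree_le2 v coverOPT) Lneq UL sortL L0.
rewrite /= mulr0 /sopc; set C := (foldl _ _ _).1.
have -> : weight W (C ++ [seq [:: v] | v <- enum T & ~~ covered C v]) = weight W C.
  rewrite /weight big_cat /= [X in _ + X]big1_seq ?addr0 // => p /andP[_ /mapP[v _ ->]].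
  by rewrite big_nil.
have -> : \sum_(f <- cover_edges OPT | f \in [seq edge x | x <- L]) W f = weight W OPT.
  rewrite weightE big_mkcond big_seq [RHS]big_seq; apply: eq_bigr => f fO.
  by rewrite memL (path_cover_edges_sub coverOPT fO).
lra.
Qed.
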